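(* Every finite distributive lattice is sharply transferable with respect to the class $\mathcal{R}_{\mathrm{mod}}$ of all relatively complemented modular lattices.
   Context: An ideal of a lattice $L$ is a nonempty subset $I$ with $x\vee y\in I$ iff $x,y\in I$; $\mathrm{Id}\,L$ is the lattice of ideals under inclusion. A lattice $P$ is sharply transferable with respect to a class $\mathcal{C}$ of lattices if for every $L\in\mathcal{C}$ and every lattice embedding $\varphi\colon P\to\mathrm{Id}\,L$, there is a lattice homomorphism $f\colon P\to L$ with $f(x)\in\varphi(x)$ for all $x\in P$ and such that $f(x)\in\varphi(y)$ implies $x\leq y$, for all $x,y\in P$. *)

(* Defs.v *)
From HB Require Import structures.
From mathcomp Require Import all_boot all_order.
From mathcomp Require Import boolp classical_sets.

Set Implicit Arguments.
Unset Strict Implicit.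
Unset Printing Implicit Defensive.

Import Order.TTheory.
Local Open Scope order_scope.

Definition is_ideal d (L : latticeType d) (I : set L) : Prop :=
  (exists x, I x) /\ (forall x y, I (x `|` y) <-> I x /\ I y).

Record ideal d (L : latticeType d) := Ideal {
  ideal_set : set L;
  ideal_setP : `[< is_ideal ideal_set >]
}.

HB.instance Definition _ d (L : latticeType d) := [isSub for @ideal_set d L].
HB.instance Definition _ d (L : latticeType d) := [Choice of ideal L by <:].

Fact ideal_display : Order.disp_t. Proof. exact: Order.Disp tt tt. Qed.

(* The order on [set L] is inclusion, so this is the inclusion order. *)
HB.instance Definition _ d (L : latticeType d) :=
  [SubChoice_isSubPOrder of ideal L by <: with ideal_display].

Section IdealLattice.
Variables (d : Order.disp_t) (L : latticeType d).
Implicit Types I J K : ideal L.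

Lemma ideal_leP I J :
  reflect (forall x, ideal_set I x -> ideal_set J x) (I <= J).
Proof. by rewrite -Order.le_val; exact: subsetPset. Qed.

Lemma idealP I : is_ideal (ideal_set I).
Proof. exact/asboolP/ideal_setP. Qed.

Lemma idealU I x y : ideal_set I x -> ideal_set I y -> ideal_set I (x `|` y).
Proof. by move=> Ix Iy; apply/(idealP I).2. Qed.

Lemma ideal_down I x y : x <= y -> ideal_set I y -> ideal_set I x.
Proof. by move=> /join_idPr <- /(idealP I).2 []. Qed.

Definition ideal_meet_set I J : set L :=
  fun x => ideal_set I x /\ ideal_set J x.

Lemma ideal_meet_proof I J : `[< is_ideal (ideal_meet_set I J) >].
Proof.
apply/asboolP; split.
  have [[x Ix] _] := idealP I; have [[y Jy] _] := idealP J.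
  exists (x `&` y); split; first exact: ideal_down (leIl x y) Ix.
  exact: ideal_down (leIr y x) Jy.
move=> x y; rewrite /ideal_meet_set.
have /(_ x y) := (idealP I).2; have /(_ x y) := (idealP J).2; tauto.
Qed.

Definition ideal_meet I J := Ideal (ideal_meet_proof I J).

Definition ideal_join_set I J : set L :=
  fun z => exists x y, [/\ ideal_set I x, ideal_set J y & z <= x `|` y].

Lemma ideal_join_proof I J : `[< is_ideal (ideal_join_set I J) >].
Proof.
apply/asboolP; split.
  have [[x Ix] _] := idealP I; have [[y Jy] _] := idealP J.
  by exists (x `|` y), x, y.
move=> z t; split=> [[x [y [Ix Jy]]]|].
  by rewrite leUx => /andP[zxy txy]; split; exists x, y.
move=> [[x [y [Ix Jy zxy]]] [x' [y' [Ix' Jy' txy]]]].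
exists (x `|` x'), (y `|` y'); split; [exact: idealU|exact: idealU|].
by rewrite joinACA leU2.
Qed.

Definition ideal_join I J := Ideal (ideal_join_proof I J).

Lemma le_ideal_meet K I J : (K <= ideal_meet I J) = (K <= I) && (K <= J).
Proof.
apply/ideal_leP/andP => [h|[/ideal_leP KI /ideal_leP KJ] x Kx].
  by split; apply/ideal_leP => x /h [].
by split; [exact: KI|exact: KJ].
Qed.

Lemma ideal_join_le I J K : (ideal_join I J <= K) = (I <= K) && (J <= K).
Proof.
apply/ideal_leP/andP => [h|[/ideal_leP IK /ideal_leP JK] z].
  have [[x Ix] _] := idealP I; have [[y Jy] _] := idealP J.
  split; apply/ideal_leP => z Hz; apply: h.
    by exists z, y; split=> //; exact: leUl.
  by exists x, z; split=> //; exact: leUr.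
by move=> [x [y [/IK Kx /JK Ky]]] /ideal_down; apply; exact: idealU.
Qed.

HB.instance Definition _ :=
  Order.POrder_MeetJoin_isLattice.Build ideal_display (ideal L)
    le_ideal_meet ideal_join_le.

End IdealLattice.

Definition modular_lattice d (L : latticeType d) : Prop :=
  forall x y z : L, x <= z -> x `|` (y `&` z) = (x `|` y) `&` z.

Definition relatively_complemented d (L : latticeType d) : Prop :=
  forall a b x : L, a <= x -> x <= b ->
    exists y : L, x `&` y = a /\ x `|` y = b.

Definition lattice_class := forall d, latticeType d -> Prop.

Definition Rmod : lattice_class :=
  fun d L => relatively_complemented L /\ modular_lattice L.

(* {lmorphism _ -> _} preserves binary meets and joins only, not bounds; together
   with injectivity it is a lattice embedding. *)
Definition sharply_transferable d (P : latticeType d) (C : lattice_class) :=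
  forall d' (L : latticeType d'), C d' L ->
  forall phi : {lmorphism P -> ideal L}, injective phi ->
  exists f : {lmorphism P -> L},
    (forall x, ideal_set (phi x) (f x)) /\
    (forall x y, ideal_set (phi y) (f x) -> x <= y).

(* Main.v *)
Require Import Defs.
From HB Require Import structures.
From mathcomp Require Import all_boot all_order.
From mathcomp Require Import boolp classical_sets.

(** List the join-primes [p] of [P] along a linear extension. For each [p] in
turn pick [b] in [phi p] lying in no [phi y] with [~~ (p <= y)], and let [a p]
be a complement in [[c, b]] of the meet of [b] with the join of the previously
chosen elements, where [c] is a fixed element of the image of the bottom of [P].
As [p] is below no join of earlier join-primes, [a p] keeps the properties of
[b]. The family [a] is independent over [c], so by modularity joins of its
subfamilies satisfy the identity (join over A) meet (join over B) = join over
(A meet B), and [f x] is the join of the [a p] with [p <= x]. *)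

Set Implicit Arguments.
Unset Strict Implicit.
Unset Printing Implicit Defensive.

Import Order.TTheory.
Local Open Scope order_scope.

(** * Finite joins over a base [c], the value of the empty join, and independence over [c] *)

Section JoinsOverBase.
Variables (d : Order.disp_t) (L : latticeType d) (c : L) (I : Type) (F : I -> L).
Implicit Types (r : seq I) (A B : pred I).

Lemma le_base_bigjoin r A : c <= \big[Order.join/c]_(i <- r | A i) F i.
Proof. by elim/big_rec: _ => // i x _ cx; rewrite lexU2 ?cx ?orbT. Qed.

Lemma bigjoin_pred_le r A :
  \big[Order.join/c]_(i <- r | A i) F i <= \big[Order.join/c]_(i <- r) F i.
Proof.
elim: r => [|i r IH]; rewrite ?big_nil // !big_cons.
by case: ifP => _; [exact: leU2|exact: lexUr].
Qed.

Lemma bigjoin_predU r A B :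
  \big[Order.join/c]_(i <- r | A i || B i) F i =
  \big[Order.join/c]_(i <- r | A i) F i `|` \big[Order.join/c]_(i <- r | B i) F i.
Proof.
elim: r => [|i r IH]; first by rewrite !big_nil joinxx.
rewrite !big_cons; case: (A i); case: (B i); rewrite /= IH //.
- by rewrite joinACA joinxx.
- by rewrite joinA.
- by rewrite joinCA.
Qed.

(** Each element is only tested against the join of the later ones; modularity extends this to all
    pairs of subfamilies. *)
Fixpoint independent r : Prop :=
  if r is i :: r' then
    F i `&` (\big[Order.join/c]_(j <- r') F j) = c /\ independent r'
  else True.

(** Since [y] is below [s], [a] matters only through [s], and modularity reduces the meet of [x]
    join [a] with [s] to [x]. *)
Lemma modular_meetUl (a s x y : L) : modular_lattice L ->
  a `&` s <= x -> x <= s -> y <= s -> (a `|` x) `&` y = x `&` y.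
Proof.
move=> mod asx xs ys; rewrite -(meet_idPl ys) (meetC y) !meetA; congr (_ `&` _).
by rewrite joinC -mod // (join_idPl asx) (meet_idPl xs).
Qed.

Lemma bigjoin_predI r A B : modular_lattice L -> independent r ->
  \big[Order.join/c]_(i <- r | A i && B i) F i =
  \big[Order.join/c]_(i <- r | A i) F i `&` \big[Order.join/c]_(i <- r | B i) F i.
Proof.
move=> mod; elim: r => [|i r IH] /=; first by rewrite !big_nil meetxx.
case=> Fi /IH{}IH; rewrite !big_cons.
have lA := bigjoin_pred_le r A; have lB := bigjoin_pred_le r B.
have cA := le_base_bigjoin r A; have cB := le_base_bigjoin r B.
case: (A i); case: (B i); rewrite /= IH //.
(* The modular law pulls out the common [F i]; a head present on one side only is absorbed, with [s]
   the join of the whole tail. *)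
- rewrite -mod ?leUl //; congr (_ `|` _).
  by rewrite [RHS]meetC (modular_meetUl mod _ lB lA) ?Fi // meetC.
- by rewrite (modular_meetUl mod _ lA lB) ?Fi.
- by rewrite [RHS]meetC (modular_meetUl mod _ lB lA) ?Fi // meetC.
Qed.

End JoinsOverBase.

Lemma ideal_bigjoin d (L : latticeType d) (J : ideal L) (c : L) (I : eqType)
    (r : seq I) (A : pred I) (F : I -> L) :
  ideal_set J c -> (forall i, i \in r -> A i -> ideal_set J (F i)) ->
  ideal_set J (\big[Order.join/c]_(i <- r | A i) F i).
Proof.
move=> Jc JF; rewrite big_seq_cond; apply: big_ind => //; first exact: idealU.
by move=> i /andP[]; exact: JF.
Qed.

Lemma le_bigjoin_mem d (L : latticeType d) (c : L) (I : eqType) (r : seq I)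
    (A : pred I) (F : I -> L) (i : I) :
  i \in r -> A i -> F i <= \big[Order.join/c]_(j <- r | A j) F j.
Proof.
move=> + Ai; elim: r => // j r IH; rewrite inE big_cons => /predU1P[<-|/IH ir].
  by rewrite Ai leUl.
by case: ifP => // _; exact: lexUr.
Qed.

(** * Join-primes of a finite distributive lattice and linear extensions of its order *)

Section JoinPrimes.
Variables (d : Order.disp_t) (P : finDistrLatticeType d).
Implicit Types p x y : P.

Definition join_prime p :=
  [exists x, ~~ (p <= x)] &&
  [forall x, forall y, (p <= x `|` y) ==> (p <= x) || (p <= y)].

Lemma join_primeU p x y : join_prime p -> (p <= x `|` y) = (p <= x) || (p <= y).
Proof.
case/andP=> _ /forallP/(_ x)/forallP/(_ y)/implyP pU.
by apply/idP/idP => // /orP[] h; rewrite lexU2 ?h ?orbT.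
Qed.

Lemma join_prime_bigjoin p x0 (r : seq P) (A : pred P) : join_prime p ->
  ~~ (p <= x0) -> {in r, forall q, A q -> ~~ (p <= q)} ->
  ~~ (p <= \big[Order.join/x0]_(q <- r | A q) q).
Proof.
move=> pp px0 pr; rewrite big_seq_cond; apply: (big_ind (fun z => ~~ (p <= z))).
- by [].
- by move=> x y px py; rewrite join_primeU // negb_or px.
- by move=> q /andP[]; exact: pr.
Qed.

(** A strictly monotone rank, used both to pick minimal elements and to sort [P]. *)
Definition downset_card x := #|[pred z | z <= x]|.

Lemma downset_card_lt x y : x < y -> (downset_card x < downset_card y)%N.
Proof.
move=> xy; apply/proper_card/fintype.properP; split.
  by apply/fintype.subsetP => z; rewrite !inE => /le_trans; apply; exact: ltW.
by exists y; rewrite !inE ?lexx // lt_geF.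
Qed.

(* A minimal [z <= x] with [~~ (z <= y)] is join-prime, by distributivity. *)
Lemma join_prime_separation x y :
  ~~ (x <= y) -> exists p, [/\ join_prime p, p <= x & ~~ (p <= y)].
Proof.
move=> xy; pose A z := (z <= x) && ~~ (z <= y).
have Ax : A x by rewrite /A lexx.
case: (arg_minnP downset_card Ax) => z /andP[zx zy] zmin.
exists z; split=> //; apply/andP; split; first by apply/existsP; exists y.
have zI u : ~~ (z <= u) -> z `&` u <= y.
  move=> zu; apply: contraT => zuy.
  have /zmin : A (z `&` u) by rewrite /A zuy andbT (le_trans _ zx) ?leIl.
  by rewrite leqNgt downset_card_lt // lt_leAnge leIl lexI lexx.
apply/forallP => u; apply/forallP => v; apply/implyP => zuv.
apply: contraNT zy; rewrite negb_or => /andP[/zI zu /zI zv].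
by rewrite -(meet_idPl zuv) meetUr leUx zu.
Qed.

Lemma linear_extension : {s : seq P | s =i predT
  & pairwise (fun p q => ~~ (p <= q)) s}.
Proof.
(* Larger down-sets come first, so an induction on the list treats the smaller elements before the
   head. *)
pose h p q := (downset_card q <= downset_card p)%N.
have htot : total h by move=> p q; exact: leq_total.
have htr : transitive h by move=> q p r hpq hqr; exact: leq_trans hqr hpq.
exists (sort h (enum P)); first by move=> p; rewrite mem_sort mem_enum.
have := sort_sorted htot (enum P); rewrite sorted_pairwise // => hs.
have : uniq (sort h (enum P)) by rewrite sort_uniq enum_uniq.
rewrite uniq_pairwise => us; have := conj hs us => /andP.
rewrite -pairwise_relI; apply: sub_pairwise => p q /= /andP[hpq npq].
apply: contraL hpq => pq; rewrite -ltnNge; apply: downset_card_lt.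
by rewrite lt_neqAle npq.
Qed.

End JoinPrimes.

(** * Choice of representatives in [L] and construction of the transfer map *)

Section Transfer.
Variables (d : Order.disp_t) (P : finDistrLatticeType d).
Variables (d' : Order.disp_t) (L : latticeType d').
Hypotheses (compL : relatively_complemented L) (modL : modular_lattice L).
Variables (phi : {lmorphism P -> ideal L}) (phiI : injective phi).
Variables (x0 : P) (x0_le : forall x, x0 <= x) (c : L) (phic : ideal_set (phi x0) c).

Definition faithful_at (p : P) (a : L) :=
  ideal_set (phi p) a /\ forall y, ideal_set (phi y) a -> p <= y.

Lemma phi_mono x y u : x <= y -> ideal_set (phi x) u -> ideal_set (phi y) u.
Proof. by move=> xy; move: u; apply/ideal_leP; exact: omorph_le. Qed.

Lemma base_mem x : ideal_set (phi x) c.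
Proof. exact: phi_mono (x0_le x) phic. Qed.

Lemma join_prime_ge_base p : join_prime p -> ~~ (p <= x0).
Proof.
case/andP=> /existsP[x px] _; apply: contra px => /le_trans; apply; exact: x0_le.
Qed.

(** The join [q] of all elements not above [p] is itself not above [p], by primeness. Injectivity
    then gives an element of [phi p] outside [phi q], hence outside every [phi y] with [y] not above
    [p]. *)
Lemma faithful_witness p : join_prime p -> exists2 b, c <= b & faithful_at p b.
Proof.
move=> pp; pose q := \big[Order.join/x0]_(x <- enum P | ~~ (p <= x)) x.
have pq : ~~ (p <= q) by apply: join_prime_bigjoin => //; exact: join_prime_ge_base.
have [b [pb nqb]] : exists b, ideal_set (phi p) b /\ ~ ideal_set (phi q) b.
  apply: contrapT => nb; case/negP: pq; apply/meet_idPl/phiI.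
  rewrite omorphI; apply/meet_idPl/ideal_leP => b pb.
  by apply: contrapT => nqb; apply: nb; exists b.
(* Joining with [c] makes the interval from [c] available for relative complements. *)
exists (b `|` c); first exact: leUr.
split; first by apply: idealU => //; exact: base_mem.
move=> y /(ideal_down (leUl b c)) yb; apply: contraT => py; case: nqb.
apply: phi_mono yb; apply: (@le_bigjoin_mem _ _ _ _ _ _ id) => //; exact: mem_enum.
Qed.

Lemma independent_faithful_family (s : seq P) :
  all (@join_prime _ P) s -> pairwise (fun p q => ~~ (p <= q)) s ->
  exists t : seq (P * L), [/\ map fst t = s, independent c snd t
    & forall u, u \in t -> faithful_at u.1 u.2].
Proof.
elim: s => [|p s IH] /=; first by exists [::].
case/andP=> pp ps /andP[psep ssep]; have [t [ts tind tf]] := IH ps ssep.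
have [b cb [pb bmin]] := faithful_witness pp.
pose S := \big[Order.join/c]_(u <- t) u.2.
have cS : c <= S by exact: le_base_bigjoin.
pose w := \big[Order.join/x0]_(q <- s) q.
have pw : ~~ (p <= w).
  apply: join_prime_bigjoin => //; first exact: join_prime_ge_base.
  by move=> q qs _; move/allP: psep; apply.
have Sw : ideal_set (phi w) S.
  apply: ideal_bigjoin => [|u ut _]; first exact: base_mem.
  apply: phi_mono (tf u ut).1; apply: (@le_bigjoin_mem _ _ _ _ _ _ id) => //.
  by rewrite -ts map_f.
have cbS : c <= b `&` S by rewrite lexI cb.
have [a [aI aU]] := compL cbS (leIl b S).
have ab : a <= b by rewrite -aU leUr.
exists ((p, a) :: t); split; rewrite /= ?ts //.
  by split=> //; rewrite -(meet_idPl ab) -meetA meetC.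
move=> u; rewrite inE => /predU1P[->|/tf //]; split; first exact: ideal_down ab pb.
(* As [b] is the join of a part of [S], which lies in [phi w], and [a], it lies in the ideal of [w]
   join [y]; primeness then discards [w]. *)
move=> y ya; have : p <= w `|` y.
  apply: bmin; rewrite -aU; apply: idealU; last exact: phi_mono (leUr _ _) ya.
  by apply: ideal_down (leIr _ _) _; exact: phi_mono (leUl _ _) Sw.
by rewrite join_primeU // (negPf pw).
Qed.

(** Meets are preserved by independence, joins by primeness of the indices. For sharpness, a
    join-prime separating [x] from [y] would have its representative in [phi y], contradicting
    faithfulness. *)
Lemma sharp_transfer_of_base : exists f : {lmorphism P -> L},
  (forall x, ideal_set (phi x) (f x)) /\
  (forall x y, ideal_set (phi y) (f x) -> x <= y).
Proof.
have [s0 s0P s0sep] := linear_extension P.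
pose s := filter (@join_prime _ P) s0.
have [||t [ts tind tf]] := @independent_faithful_family s.
- exact: filter_all.
- exact: pairwise_filter.
have tprime u : u \in t -> join_prime u.1.
  by move=> /(map_f fst); rewrite ts mem_filter => /andP[].
pose f x := \big[Order.join/c]_(u <- t | u.1 <= x) u.2.
have fI : {morph f : x y / x `&` y}.
  move=> x y; rewrite /f -bigjoin_predI //.
  by apply: eq_bigl => u; rewrite lexI.
have fU : {morph f : x y / x `|` y}.
  move=> x y; rewrite /f -bigjoin_predU big_seq_cond [RHS]big_seq_cond.
  by apply: eq_bigl => u; case: (boolP (u \in t)) => //= /tprime/join_primeU->.
have fle : {homo f : x y / x <= y}.
  by move=> x y /meet_idPl xy; rewrite -xy fI leIr.
pose fO := Order.isOrderMorphism.Build _ P _ L f fle.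
pose fo : Order.OrderMorphism.type P L := HB.pack f fO.
pose fL := Order.isLatticeMorphism.Build _ P _ L fo fI fU.
pose fl : {lmorphism P -> L} := HB.pack f fO fL.
exists fl; split=> [x|x y fxy].
  apply: ideal_bigjoin => [|u ut ux]; first exact: base_mem.
  exact: phi_mono ux (tf u ut).1.
apply: contraT => /join_prime_separation[p [pp px]].
have : p \in map fst t by rewrite ts mem_filter pp s0P.
case/mapP=> u ut pu; rewrite pu (tf u ut).2 //.
apply: ideal_down fxy; apply: (@le_bigjoin_mem _ _ _ _ _ _ snd) => //.
by rewrite -pu.
Qed.

End Transfer.

Theorem theorem4p1 (d : Order.disp_t) (P : finDistrLatticeType d) :
  sharply_transferable P Rmod.
Proof.
move=> d' L [compL modL] phi phiI.
(* If [P] is inhabited, the meet of all its elements is the bottom; otherwise the empty map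
   serves. *)
case: (pickP (@predT P)) => [x1 _|P0].
  pose x0 := \big[Order.meet/x1]_(x <- enum P) x.
  have x0_le x : x0 <= x.
    have : x \in enum P by rewrite mem_enum.
    rewrite /x0; elim: (enum P) => // y r IH; rewrite inE big_cons.
    by case/predU1P=> [->|/IH]; [exact: leIl|exact: leIxr].
  have [[c cx0] _] := idealP (phi x0).
  exact: sharp_transfer_of_base x0_le c cx0.
have noP (x : P) : False by have := P0 x.
pose f (x : P) : L := False_rect L (noP x).
pose fO := Order.isOrderMorphism.Build _ P _ L f (fun x => False_ind _ (noP x)).
pose fo : Order.OrderMorphism.type P L := HB.pack f fO.
pose fL := Order.isLatticeMorphism.Build _ P _ L fo
  (fun x => False_ind _ (noP x)) (fun x => False_ind _ (noP x)).
pose fl : {lmorphism P -> L} := HB.pack f fO fL.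
by exists fl; split=> x; case: (noP x).
Qed.
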